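(* Let $G$ be a countable group and let $X$ be an infinite $G$-space possessing a syndetic submeasure $\mu:\mathcal P(X)\to[0,1]$. Then for every $k\in\mathbb N$ there is a partition $X=A\cup B$ of $X$ into two $k$-meager subsets.
   Context: $\mathbb N=\{1,2,3,\dots\}$. A $G$-space is a non-empty set $X$ endowed with a left action of a group $G$. For $F\subset G$ and $A\subset X$ put $FA=\{fa:f\in F,\ a\in A\}\subset X$. A subset $A\subset X$ is called: large if $FA=X$ for some finite $F\subset G$; thick if for each finite $F\subset G$ there is $x\in X$ with $Fx\subset A$; $k$-meager (for $k\in\mathbb N$) if $KA$ is not thick for any $K\subset G$ of cardinality $|K|\le k$. Let $\mathcal P(X)$ be the family of all subsets of $X$. A function $\mu:\mathcal P(X)\to[0,1]$ is a submeasure if it is monotone ($\mu(A)\le\mu(B)$ for $A\subset B\subset X$), subadditive ($\mu(A\cup B)\le\mu(A)+\mu(B)$ for all $A,B\subset X$), $\mu(\emptyset)=0$ and $\mu(X)=1$. It is $G$-invariant if $\mu(gA)=\mu(A)$ for all $g\in G$, $A\subset X$. A syndetic submeasure is a $G$-invariant submeasure $\mu$ such that for each $A\subset X$ with $\mu(A)<1$ and each real $\varepsilon>\frac1{|X|}$ there is a large subset $L\subset X\setminus A$ with $\mu(L)<\varepsilon$; here $\frac1{|X|}=0$ if $X$ is infinite. *)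

(* Defs.v *)
From HB Require Import structures.
From mathcomp Require Import all_boot all_order all_algebra all_fingroup.
From mathcomp Require Import all_classical all_reals.

Set Implicit Arguments.
Unset Strict Implicit.
Unset Printing Implicit Defensive.

Import Order.TTheory GRing.Theory Num.Theory.
Local Open Scope classical_set_scope.
Local Open Scope card_scope.
Local Open Scope ring_scope.

(* MathComp's [action] covers finite groups only, so left actions of an
   arbitrary [groupType] are spelled out here. *)
Record Gspace (G : groupType) (X : Type) (act : G -> X -> X) : Prop := {
  Gspace_nonempty : [set: X] !=set0;
  Gspace_act1 : forall x, act 1%g x = x;
  Gspace_actM : forall g h x, act (g * h)%g x = act g (act h x) }.

Section Subsets.
Variables (G : groupType) (X : Type) (act : G -> X -> X).

Definition translates (F : set G) (A : set X) : set X :=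
  [set act f a | f in F & a in A].

Definition large (A : set X) : Prop :=
  exists F : set G, finite_set F /\ translates F A = [set: X].

Definition thick (A : set X) : Prop :=
  forall F : set G, finite_set F ->
  exists x : X, translates F [set x] `<=` A.

Definition meager (k : nat) (A : set X) : Prop :=
  forall K : set G, K #<= `I_k -> ~ thick (translates K A).

End Subsets.

(* 1/|X|, read as 0 when X is infinite. *)
Definition inv_card (R : realType) (X : Type) : R :=
  if `[< finite_set [set: X] >]
  then ((xget 0%N [set n : nat | [set: X] #= `I_n])%:R)^-1
  else 0.

Record submeasure (R : realType) (X : Type) (mu : set X -> R) : Prop := {
  submeasure_itv : forall A, 0 <= mu A <= 1;
  submeasure_mono : forall A B, A `<=` B -> mu A <= mu B;
  submeasure_subadd : forall A B, mu (A `|` B) <= mu A + mu B;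
  submeasure0 : mu set0 = 0;
  submeasureT : mu [set: X] = 1 }.

Record syndetic_submeasure (R : realType) (G : groupType) (X : Type)
    (act : G -> X -> X) (mu : set X -> R) : Prop := {
  syndetic_submeasureP : submeasure mu;
  syndetic_invariant : forall (g : G) (A : set X), mu (act g @` A) = mu A;
  syndetic_large : forall (A : set X) (eps : R),
    mu A < 1 -> inv_card R X < eps ->
    exists L : set X, [/\ large act L, L `<=` ~` A & mu L < eps] }.

(* Main.v *)
Require Import Defs.
From HB Require Import structures.
From mathcomp Require Import all_boot all_order all_algebra all_fingroup.
From mathcomp Require finmap.
From mathcomp Require Import all_classical all_reals.

(** A set [K A] fails to be thick as soon as some large set [L] satisfies
    [K^-1 L `&` A = set0]. There are countably many sets [K_0, K_1, ...] of at
    most [k] elements, so it suffices to build increasing sequences [P_n], [Q_n]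
    with [P_n] disjoint from [Q_n] such that [P_n.+1] and [Q_n.+1] each contain
    [K_n^-1 L] for some large [L]. The invariant [mu P_n, mu Q_n < 1/k] keeps
    the recursion going: it gives [mu (K_n Q_n) < 1], hence a large [L] disjoint
    from [K_n Q_n] with [mu L] so small that [mu (P_n `|` K_n^-1 L) < 1/k], and
    [L] being disjoint from [K_n Q_n] means that [K_n^-1 L] is disjoint from
    [Q_n]. *)

Set Implicit Arguments.
Unset Strict Implicit.

Import Order.TTheory GRing.Theory Num.Theory.
Local Open Scope classical_set_scope.
Local Open Scope card_scope.
Local Open Scope ring_scope.

Section GspaceTheory.
Variables (G : groupType) (X : Type) (act : G -> X -> X).
Hypothesis XGspace : Gspace act.

Lemma actK (g : G) : cancel (act g) (act g^-1%g).
Proof.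
by move=> x; rewrite -(Gspace_actM XGspace) mulVg (Gspace_act1 XGspace).
Qed.

Lemma actVK (g : G) : cancel (act g^-1%g) (act g).
Proof.
by move=> x; rewrite -(Gspace_actM XGspace) mulgV (Gspace_act1 XGspace).
Qed.

(** Write [F L = X] with [F] finite and test thickness of [K A] on [F^-1]. It yields [x] with
    [F^-1 x] inside [K A]; since [x = f l] for some [f] in [F] and [l] in [L], the point
    [l = f^-1 x] has the form [g a] with [g] in [K], so [a = g^-1 l] lies in [A], which is
    excluded. *)
Lemma large_not_thick (K : set G) (A L : set X) :
  large act L -> (forall g l, K g -> L l -> ~ A (act g^-1%g l)) ->
  ~ thick act (translates act K A).
Proof.
move=> [F [Ffin FL]] KLA /(_ ((fun g : G => g^-1%g) @` F) (finite_image _ Ffin))[x Fx].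
have : translates act F L x by rewrite FL.
move=> [f Ff [l Ll flx]].
have [|g Kg [a Aa gal]] := Fx l.
- by exists f^-1%g; [exists f|exists x => //; rewrite -flx actK].
- by apply: (KLA g l Kg Ll); rewrite -gal actK.
Qed.

End GspaceTheory.

Lemma card_le_seq (T : choiceType) (k : nat) (K : set T) :
  K #<= `I_k -> exists2 s : seq T, (size s <= k)%N & K = [set` s].
Proof.
move=> Kk.
have [n Kn] : finite_set K by exact: card_le_finite Kk _.
exists (finmap.enum_fset (fset_set K)); last by rewrite -[LHS]fset_setK//; exists n.
rewrite [size _](card_fset_set Kn) -card_le_II; apply: card_le_trans Kk.
by have /card_eqPle[] := Kn.
Qed.

Lemma countable_bounded_seq (T : choiceType) (k : nat) :
  countable [set: T] -> exists u : nat -> seq T,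
    (forall n, (size (u n) <= k)%N) /\
    forall s, (size s <= k)%N -> exists n, u n = s.
Proof.
move=> /countable_injP[f /in2TT f_inj].
pose P n : set (seq T) := [set s | (size s <= k)%N /\ pickle (map f s) = n].
(* An index that codes no short list yields the default [[::]], whose size is 0, so the bound holds
   at every [n]. *)
exists (fun n => xget [::] (P n)); split=> [n|s sk].
  by case: xgetP => [s _ []|].
exists (pickle (map f s)).
case: xgetP => [t _ [_ /(pcan_inj pickleK)/(inj_map f_inj)]|/(_ s)] //.
by case; split.
Qed.

Section SyndeticSubmeasure.
Variables (R : realType) (G : groupType) (X : Type) (act : G -> X -> X).
Variable mu : set X -> R.
Hypothesis XGspace : Gspace act.
Hypothesis mu_syndetic : syndetic_submeasure act mu.

Let mu_sub := syndetic_submeasureP mu_syndetic.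

(** The union bound: each translate [g A] has the submeasure of [A] by invariance, and repetitions
    in [s] only weaken the estimate. *)
Lemma submeasure_translates (s : seq G) (A : set X) :
  mu (translates act [set` s] A) <= (size s)%:R * mu A.
Proof.
elim: s => [|g s IHs].
  rewrite (_ : translates _ _ _ = set0) ?(submeasure0 mu_sub) ?mul0r//.
  by apply/seteqP; split=> x // [].
rewrite /= -natr1 mulrDl mul1r addrC.
apply: le_trans (lerD (lexx _) IHs).
rewrite -(syndetic_invariant mu_syndetic g A).
apply: le_trans (submeasure_subadd mu_sub _ _).
apply: (submeasure_mono mu_sub) => x [h /=]; rewrite inE => /orP[/eqP->|hs].
  by move=> [a Aa <-]; left; exists a.
by move=> [a Aa <-]; right; exists h => //; exists a.
Qed.

Hypothesis Xinfinite : infinite_set [set: X].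
Variable k : nat.
Hypothesis k_gt0 : (0 < k)%N.

Lemma extend_avoiding (s : seq G) (P Q : set X) :
  (size s <= k)%N -> P `&` Q = set0 ->
  mu P < k%:R^-1 -> mu Q < k%:R^-1 ->
  exists P' L : set X,
    [/\ P `<=` P', P' `&` Q = set0, mu P' < k%:R^-1, large act L &
        forall g l, g \in s -> L l -> P' (act g^-1%g l)].
Proof.
move=> sk PQ0 Pk Qk.
have k0 : 0 < k%:R :> R by rewrite ltr0n.
have mu_ge0 A : 0 <= mu A by case/andP: (submeasure_itv mu_sub A).
have translates_le (t : seq G) A : (size t <= k)%N ->
    mu (translates act [set` t] A) <= k%:R * mu A.
  move=> tk; apply: le_trans (submeasure_translates t A) _.
  by rewrite ler_wpM2r// ler_nat.
have sQ1 : mu (translates act [set` s] Q) < 1.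
  by apply: le_lt_trans (translates_le _ _ sk) _; rewrite mulrC -ltr_pdivlMr// div1r.
(* The room left above [mu P] is shared among at most [k] translates of [L]. As [X] is infinite,
   [inv_card R X] is 0 and any positive bound is allowed. *)
have inv_card_lt : inv_card R X < (k%:R^-1 - mu P) / k%:R.
  by rewrite /inv_card asboolF// divr_gt0// subr_gt0.
have [L [L_large LsQ Lsmall]] :=
  syndetic_large mu_syndetic sQ1 inv_card_lt.
exists (P `|` translates act [set` [seq g^-1%g | g <- s]] L), L; split=> //.
- rewrite setIUl PQ0 set0U; apply/seteqP; split=> // x [].
  move=> [_ /mapP[g gs ->] [l Ll <-]] Ql; apply: (LsQ l Ll).
  by exists g => //; exists (act g^-1%g l) => //; exact: actVK.
- apply: le_lt_trans (submeasure_subadd mu_sub _ _) _.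
  rewrite -ltrBrDl; apply: le_lt_trans (translates_le _ _ _) _.
    by rewrite size_map.
  by rewrite mulrC -ltr_pdivlMr.
- move=> g l gs Ll; right; exists g^-1%g; first exact: map_f.
  by exists l.
Qed.

Definition small_disjoint (PQ : set X * set X) : Prop :=
  [/\ PQ.1 `&` PQ.2 = set0, mu PQ.1 < k%:R^-1 & mu PQ.2 < k%:R^-1].

Definition extends_for (s : seq G) (PQ PQ' : set X * set X) : Prop :=
  [/\ PQ.1 `<=` PQ'.1, PQ.2 `<=` PQ'.2,
      exists2 L, large act L &
        forall g l, g \in s -> L l -> PQ'.1 (act g^-1%g l) &
      exists2 L, large act L &
        forall g l, g \in s -> L l -> PQ'.2 (act g^-1%g l)].

Lemma extend_pair (s : seq G) (PQ : set X * set X) :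
  (size s <= k)%N -> small_disjoint PQ ->
  exists2 PQ', small_disjoint PQ' & extends_for s PQ PQ'.
Proof.
case: PQ => P Q sk [/= PQ0 Pk Qk].
have [P' [L [PP' P'Q P'k L_large LP']]] := extend_avoiding sk PQ0 Pk Qk.
rewrite setIC in P'Q.
(* The roles are exchanged, and [Q] must avoid the already enlarged [P'], so that the new pair is
   still disjoint. *)
have [Q' [M [QQ' Q'P' Q'k M_large MQ']]] := extend_avoiding sk P'Q Qk P'k.
exists (P', Q'); first by split=> //=; rewrite setIC.
by split=> //=; [exists L|exists M].
Qed.

Lemma extending_sequence (u : nat -> seq G) :
  (forall n, (size (u n) <= k)%N) ->
  exists PQ : nat -> set X * set X,
    forall n, small_disjoint (PQ n) /\ extends_for (u n) (PQ n) (PQ n.+1).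
Proof.
move=> uk; pose T := {PQ | small_disjoint PQ}.
(* The invariant is packed into [T], so that every state has a successor; the index is part of the
   argument because step [n] treats the list [u n]. *)
have /choice[f fP] (nt : nat * T) :
    exists t' : T, extends_for (u nt.1) (sval nt.2) (sval t').
  case: nt => n [PQ PQ_small]; have [PQ' small ext] := extend_pair (uk n) PQ_small.
  by exists (exist _ PQ' small).
have small0 : small_disjoint (set0, set0).
  by split; rewrite /= ?setI0// (submeasure0 mu_sub) invr_gt0 ltr0n.
pose t := fix t n := if n is m.+1 then f (m, t m) else exist _ _ small0.
exists (fun n => sval (t n)) => n; split; first exact: svalP (t n).
exact: fP (n, t n).
Qed.

End SyndeticSubmeasure.

(** A common point of the unions, found at stages [m] and [n], is already common to both sets at
    stage [maxn m n]. *)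
Lemma disjoint_bigcup_nondecreasing (X : Type) (P Q : nat -> set X) :
  (forall n, P n `<=` P n.+1) -> (forall n, Q n `<=` Q n.+1) ->
  (forall n, P n `&` Q n = set0) -> (\bigcup_n P n) `&` (\bigcup_n Q n) = set0.
Proof.
have mono (S : nat -> set X) : (forall n, S n `<=` S n.+1) ->
    forall m n, (m <= n)%N -> S m `<=` S n.
  move=> S_ext m n /subnK <-; elim: (n - m)%N => // i IHi.
  exact: subset_trans IHi (S_ext _).
move=> PP QQ PQ0; apply/seteqP; split=> // x [[m _ Pm] [n _ Qn]].
rewrite -(PQ0 (maxn m n)); split.
  exact: mono (leq_maxl m n) _ Pm.
exact: mono (leq_maxr m n) _ Qn.
Qed.

Unset Implicit Arguments.
Set Strict Implicit.
Local Close Scope ring_scope.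
Local Close Scope card_scope.

Theorem theorem2p2 (R : realType) (G : groupType) (X : Type)
    (act : G -> X -> X)
    (Gcountable : countable [set: G])
    (XGspace : Gspace act)
    (Xinfinite : infinite_set [set: X])
    (mu : set X -> R) (mu_syndetic : syndetic_submeasure act mu)
    (k : nat) (k_gt0 : (0 < k)%N) :
  exists A B : set X,
    [/\ A `|` B = [set: X], A `&` B = set0, meager act k A & meager act k B].
Proof.
have [u [uk u_onto]] := countable_bounded_seq k Gcountable.
have [PQ PQP] :=
  extending_sequence XGspace mu_syndetic Xinfinite k_gt0 uk.
pose A := \bigcup_n (PQ n).1.
have AQ0 : A `&` \bigcup_n (PQ n).2 = set0.
  by apply: disjoint_bigcup_nondecreasing => m; case: (PQP m) => [[? ? ?] []].
have AQ n x : A x -> ~ (PQ n).2 x.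
  move=> Ax Qx; suff: (A `&` \bigcup_n (PQ n).2) x by rewrite AQ0.
  by split=> //; exists n.
(* The second part is the full complement of [A], which makes the partition automatic. The
   meagerness of each part comes from the large set on the opposite side: [M] for [A], [L] for its
   complement. *)
exists A, (~` A); split; [exact: setUv|exact: setICr| |];
  move=> K /card_le_seq[s /u_onto[n <-] ->];
  have [_ [_ _ [L L_large LP] [M M_large MQ]]] := PQP n.
- apply: (large_not_thick XGspace M_large) => g l gs Ml Al.
  exact: AQ Al (MQ g l gs Ml).
- apply: (large_not_thick XGspace L_large) => g l gs Ll; apply.
  by exists n.+1 => //; exact: LP.
Qed.
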